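(* Let $p$ and $q$ be distinct primes and let $D = A \rtimes B$ be a semidirect product of its subgroups $A$ and $B$ (with $A$ normal in $D$) such that $A$ is a cyclic $p$-group, $B$ is a cyclic group of order $q$, and $[A,B] \neq 1$. Suppose that $X$ and $Y$ are locally finite groups and that $D$ is a section of the direct product $X \times Y$. Then $D$ is a section of $X$ or $D$ is a section of $Y$.
   Context: A section of a group $G$ is a homomorphic image of a subgroup of $G$; ''$D$ is a section of $G$'' means that $D$ is isomorphic to $S/N$ for some subgroup $S \le G$ and some normal subgroup $N$ of $S$. A group is locally finite if each of its finitely generated subgroups is finite. A $p$-group here (for the cyclic group $A$) is a finite group of order a power of $p$. $[A,B]$ is the subgroup generated by all commutators $[a,b]$ with $a\in A$, $b\in B$. *)

(* Defs.v *)
From HB Require Import structures.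
From mathcomp Require Import all_boot all_fingroup.
From mathcomp Require Import all_solvable.
From mathcomp Require Import boolp classical_sets functions cardinality.

Set Implicit Arguments.
Unset Strict Implicit.
Unset Printing Implicit Defensive.

Local Open Scope classical_set_scope.
Local Open Scope group_scope.

(* [groupType] is the library's structure of (possibly infinite) groups;
   [{group gT}] only covers subgroups of finite groups, so subgroups of an
   arbitrary group are Prop-valued subsets here. *)
Section Subgroups.
Variable G : groupType.
Implicit Types (A B S N H : set G) (x : G).

Definition is_subgroup S : Prop :=
  [/\ S 1, forall x y, S x -> S y -> S (x * y) & forall x, S x -> S x^-1].

Definition is_normal_subgroup N S : Prop :=
  [/\ is_subgroup N, N `<=` S & forall x n, S x -> N n -> N (n ^ x)].

Definition subgroup_generated A : set G := smallest is_subgroup A.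

Definition finitely_generated H : Prop :=
  exists2 A, finite_set A & H = subgroup_generated A.

Definition set_product A B : set G := [set x * y | x in A & y in B].

Definition left_coset x N : set G := [set x * n | n in N].

(* The elements of S/N; for N normal in S, its group law is [set_product]. *)
Definition quotient_cosets S N : set (set G) := [set left_coset x N | x in S].

End Subgroups.

Definition locally_finite (G : groupType) : Prop :=
  forall H : set G, is_subgroup H -> finitely_generated H -> finite_set H.

Definition isomorphic_to_quotient (D G : groupType) (S N : set G) : Prop :=
  exists2 phi : D -> set G,
    set_bij setT (quotient_cosets S N) phi &
    forall a b, phi (a * b) = set_product (phi a) (phi b).

Definition is_section (D G : groupType) : Prop :=
  exists S N : set G,
    [/\ is_subgroup S, is_normal_subgroup N S & isomorphic_to_quotient D S N].

(* Main.v *)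
Require Import Defs.
From HB Require Import structures.
From mathcomp Require Import boolp classical_sets cardinality.
From mathcomp Require Import all_boot all_fingroup all_solvable.

Set Implicit Arguments.
Unset Strict Implicit.
Unset Printing Implicit Defensive.

Local Open Scope group_scope.

(** Replace the section by a finite group [G] mapping onto [D], with the kernels
    [K], [L] of the two projections to [X] and [Y] meeting trivially: lift each
    element of [D], and keep the part of the section whose coordinates lie in
    the subgroups of [X] and [Y] generated by the coordinates of these lifts,
    which are finite by local finiteness ([finite_graph]).  If [K] maps
    trivially to [D], then [D] is a quotient of [G / K], a subgroup of [X].
    It may happen that neither [K] nor [L] maps trivially, so [G] must first be
    made smaller.

    Choose a subgroup [H] of [G] minimal among those mapping onto [D], and let
    [P] be a Sylow [p]-subgroup of [H].  Minimality has two effects.  By the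
    Frattini argument [P] is normal in [H] ([minimal_cover_Sylow]).  By
    Gaschutz's splitting theorem the part of [P] killed in [D] lies in the
    Frattini subgroup of [P] ([minimal_cover_kernel]).  So [P] modulo its
    Frattini subgroup is a quotient of the cyclic group [A], and [P] itself is
    cyclic ([cyclic_Sylow_cover]).

    A nontrivial cyclic [p]-group has a unique subgroup of order [p], so one of
    [K], [L] meets [P] trivially.  That subgroup meets [H] in a [p']-group,
    whose image in [D] is a normal [p']-subgroup; it centralises [A], and since
    [A] is its own centraliser the image is trivial
    ([cover_modulo_factor]).  Hence [D] is a section of the corresponding
    factor.

    Sections of infinite groups are handled through their graphs: [D] is a
    section of [G] exactly when some subgroup of [D * G] projects onto [D] and
    meets [D * 1] trivially. *)

(** * Minimal covers of a group with a cyclic normal Sylow subgroup *)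

(** The preimage [T] of [A] is normal with Sylow subgroup [P], so the Frattini
    argument gives [G = T * 'N_G(P)].  As [f @* T = A = f @* P], the normaliser
    already maps onto [f @* G], and by minimality it is [G]. *)
Lemma minimal_cover_Sylow (p : nat) (gT rT : finGroupType) (G : {group gT})
    (f : {morphism G >-> rT}) (A : {group rT}) (P : {group gT}) :
  (forall K : {group gT}, K \subset G -> f @* K = f @* G -> K :=: G) ->
  A <| f @* G -> p.-Sylow(f @* G) A -> p.-Sylow(G) P ->
  P <| G /\ f @* P = A.
Proof.
move=> minG nsAG sylA sylP.
have sPG := pHall_sub sylP.
have fP : f @* P = A.
  have sylfP := morphim_pHall f sPG sylP.
  apply/eqP; rewrite eqEcard (sub_normal_Hall sylA nsAG) ?morphimS //.
  by rewrite (pHall_pgroup sylfP) (card_Hall sylfP) (card_Hall sylA) /=.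
split=> //; pose T := (f @*^-1 A)%G.
have nsTG : T <| G.
  have <- : f @*^-1 (f @* G) = G by rewrite morphimGK ?subsetIl.
  by rewrite morphpre_normal ?normal_sub.
have sPT : P \subset T by rewrite -sub_morphim_pre // fP.
have /(congr1 (fun B => f @* B)) :=
  Frattini_arg nsTG (pHall_subl sPT (normal_sub nsTG) sylP).
rewrite morphimMl ?normal_sub // morphpreK ?normal_sub //.
have sAN : A \subset f @* 'N_G(P).
  by rewrite -fP morphimS // subsetI sPG normG.
rewrite mulSGid // => /minG; rewrite subsetIl => /(_ isT) defG.
by rewrite /normal sPG -{1}defG subsetIr.
Qed.

(** Write [M] for the left-hand side.  The image of [M] in the elementary abelian
    group [P / 'Phi(P)] has a complement there, hence by Gaschutz a complement
    in [G / 'Phi(P)].  The preimage [K] of that complement satisfies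
    [M * K = G], so it covers [f @* G]; then [K = G] and the image of [M] is
    trivial. *)
Lemma minimal_cover_kernel (p : nat) (gT rT : finGroupType) (G : {group gT})
    (f : {morphism G >-> rT}) (P : {group gT}) :
  (forall K : {group gT}, K \subset G -> f @* K = f @* G -> K :=: G) ->
  P <| G -> p.-Sylow(G) P -> P :&: 'ker f \subset 'Phi(P).
Proof.
move=> minG nsPG sylP; set M := (P :&: 'ker f)%G.
have pP := pHall_pgroup sylP.
have nsFG : 'Phi(P) <| G by apply: gFnormal_trans.
have nsMG : M <| G by rewrite normalI // ker_normal.
have nFM : M \subset 'N('Phi(P)).
  by rewrite (subset_trans (normal_sub nsMG)) ?normal_norm.
have sMP : M / 'Phi(P) \subset P / 'Phi(P) by rewrite quotientS ?subsetIl.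
have abelP := Phi_quotient_abelem pP.
have : [splits G / 'Phi(P), over M / 'Phi(P)].
  rewrite (Gaschutz_split (P := (P / 'Phi(P))%G)) ?quotient_normal ?quotientS //.
  - exact: abelem_splits abelP sMP.
  - exact: subsetIl.
  - exact: normal_sub nsPG.
  - exact: abelianS sMP (abelem_abelian abelP).
  - have sylPb : p.-Sylow(G / 'Phi(P)) (P / 'Phi(P)).
      by rewrite quotient_pHall // (subset_trans (normal_sub nsPG)) //
        normal_norm.
    apply: pnat_coprime (pgroupS sMP (pHall_pgroup sylPb)) _.
    by case/and3P: sylPb.
case/splitsP=> Kb /complP[tiMK defG].
have sKbG : Kb \subset G / 'Phi(P) by rewrite -defG mulG_subr.
case: (inv_quotientS nsFG sKbG) => K defKb sFK sKG.
have defMK : G \subset M * K.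
  have : G / 'Phi(P) \subset (M * K) / 'Phi(P).
    by rewrite quotientMl // -defKb defG.
  rewrite quotientSK ?normal_norm // => /subset_trans; apply.
  by rewrite mulgA -(normC nFM) -mulgA (mulSGid sFK).
have defK : K :=: G.
  apply: minG => //; apply/eqP; rewrite eqEsubset morphimS //=.
  apply: subset_trans (morphimS f defMK) _.
  rewrite morphimMl ?normal_sub // (_ : f @* M = 1) ?mul1g //.
  apply/trivgP; rewrite sub_morphim_pre ?(normal_sub nsMG) //; exact: subsetIr.
rewrite -(quotient_sub1 nFM) -tiMK subsetI subxx /= defKb defK quotientS //.
exact: normal_sub.
Qed.

(** If [x] in [P] lifts a generator of [A], then [P] is generated by [x] and the
    kernel of [P -> A].  That kernel consists of non-generators by
    [minimal_cover_kernel], so [P = <[x]>]. *)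
Lemma cyclic_Sylow_cover (p : nat) (gT rT : finGroupType) (G : {group gT})
    (f : {morphism G >-> rT}) (A : {group rT}) :
  A <| f @* G -> p.-Sylow(f @* G) A -> cyclic A ->
  exists H P : {group gT}, [/\ H \subset G, f @* H = f @* G, P <| H,
    p.-Sylow(H) P & cyclic P /\ f @* P = A].
Proof.
move=> nsAG sylA cycA.
pose cover (H : {group gT}) := (H \subset G) && (f @* H == f @* G).
have [|H /mingroupP[/andP[sHG /eqP defH] minH] _] := @mingroup_exists _ cover G.
  by rewrite /cover subxx eqxx.
pose g := [morphism of restrm sHG f].
have gE (B : {set gT}) : B \subset H -> g @* B = f @* B.
  by move=> sBH; rewrite morphim_restrm (setIidPr sBH).
have gH : g @* H = f @* G by rewrite gE.
have min_g (K : {group gT}) : K \subset H -> g @* K = g @* H -> K :=: H.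
  move=> sKH; rewrite gH gE // => fK; rewrite (minH K) //.
  by rewrite /cover (subset_trans sKH) // fK eqxx.
have [P sylP] := Sylow_exists p H.
rewrite -gH in nsAG sylA.
have [nsPH gP] := minimal_cover_Sylow min_g nsAG sylA sylP.
have sPH := normal_sub nsPH.
exists H, P; split=> //; split; last by rewrite -gE.
case/cyclicP: cycA => a defA.
have /morphimP[x Hx Px ax] : a \in g @* P by rewrite gP defA cycle_id.
apply/cyclicP; exists x; apply/esym/Phi_nongen/eqP.
rewrite eqEsubset join_subG gFsub sub1set Px /= joingE.
have sPkx : P \subset 'ker g * <[x]>.
  by rewrite -morphimSK // gP defA ax morphim_cycle.
have sPMx : P \subset (P :&: 'ker g) * <[x]>.
  by rewrite group_modr ?cycle_subG // subsetI subxx.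
apply: subset_trans sPMx _; rewrite mul_subG //.
  apply: subset_trans (minimal_cover_kernel min_g nsPH sylP) _.
  exact: joing_subl.
by rewrite cycle_subG mem_gen // inE set11 orbT.
Qed.

(** * Eliminating one of two independent normal subgroups *)

(** Every nontrivial subgroup of [P] contains ['Ohm_1(P)], which has order [p]. *)
Lemma cyclic_pgroup_TI (p : nat) (gT : finGroupType) (P K L : {group gT}) :
  cyclic P -> p.-group P -> K :&: L = 1 -> P :&: K = 1 \/ P :&: L = 1.
Proof.
move=> cycP pP tiKL.
have [P1 | ntP] := eqVneq (P : {set gT}) 1.
  by left; apply/trivgP; rewrite /= P1 subsetIl.
have prO : prime #|'Ohm_1(P)|.
  rewrite (Ohm1_cyclic_pgroup_prime cycP pP ntP).
  by have [] := pgroup_pdiv pP ntP.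
have ti (M : {group gT}) : ~~ ('Ohm_1(P) \subset M) -> P :&: M = 1.
  by move=> nsOM; rewrite setIC; apply: TI_Ohm1; rewrite setIC prime_TIg.
have [sOK | /ti] := boolP ('Ohm_1(P) \subset K); last by left.
have [sOL | /ti] := boolP ('Ohm_1(P) \subset L); last by right.
have : 'Ohm_1(P) \subset K :&: L by rewrite subsetI sOK.
by rewrite tiKL => /subset_leq_card; rewrite cards1 leqNgt prime_gt1.
Qed.

(** The subgroup that meets the cyclic Sylow subgroup [P] of the minimal cover
    trivially is a [p']-group inside [H], since [P] contains every [p]-subgroup
    of [H].  Its image is normal and meets the [p]-group [A] trivially, so it
    lies in ['C(A)], hence in [A], hence in the trivial group. *)
Lemma cover_modulo_factor (p : nat) (gT rT : finGroupType) (G K L : {group gT})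
    (f : {morphism G >-> rT}) (A : {group rT}) :
  A <| f @* G -> p.-Sylow(f @* G) A -> cyclic A -> 'C_(f @* G)(A) \subset A ->
  K <| G -> L <| G -> K :&: L = 1 ->
  exists2 H : {group gT}, H \subset G /\ f @* H = f @* G &
    f @* (H :&: K) = 1 \/ f @* (H :&: L) = 1.
Proof.
move=> nsAG sylA cycA cAA nsK nsL tiKL.
have [H [P [sHG fH nsPH sylP [cycP fP]]]] := cyclic_Sylow_cover nsAG sylA cycA.
exists H => //.
have trivial_image (M : {group gT}) :
  M <| G -> P :&: M = 1 -> f @* (H :&: M) = 1.
  move=> nsMG tiPM.
  have nsHM : H :&: M <| H by rewrite (normalGI sHG).
  have p'M : p^'.-group (H :&: M).
    have [Q sylQ] := Sylow_exists p (H :&: M)%G.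
    have sQHM := pHall_sub sylQ.
    have sQP : Q \subset P.
      rewrite (sub_normal_Hall sylP nsPH) ?(pHall_pgroup sylQ) //.
      exact: subset_trans sQHM (subsetIl _ _).
    have Q1 : Q :=: 1.
      apply/trivgP.
      by rewrite -tiPM subsetI sQP (subset_trans sQHM) ?subsetIr.
    rewrite /pgroup -partn_eq1 ?cardG_gt0 // -(card_Hall sylQ) Q1.
    by rewrite cards1.
  have nsfM : f @* (H :&: M) <| f @* G by rewrite -fH morphim_normal.
  have tiAM : A :&: f @* (H :&: M) = 1.
    apply: coprime_TIg.
    exact: pnat_coprime (pHall_pgroup sylA) (morphim_pgroup _ p'M).
  apply/trivgP; rewrite -tiAM subsetI subxx andbT.
  apply: subset_trans cAA; rewrite subsetI (normal_sub nsfM) /=.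
  apply/commG1P/trivgP; rewrite -tiAM subsetI commg_subr commg_subl.
  apply/andP; split.
    exact: subset_trans (normal_sub nsfM) (normal_norm nsAG).
  exact: subset_trans (normal_sub nsAG) (normal_norm nsfM).
by case: (cyclic_pgroup_TI cycP (pHall_pgroup sylP) tiKL) => /trivial_image;
  [left | right]; auto.
Qed.

Lemma sdprod_prime_cent (gT : finGroupType) (G A B : {group gT}) :
  A ><| B = G -> abelian A -> prime #|B| -> [~: A, B] != 1 ->
  'C_G(A) \subset A.
Proof.
move=> defG abA prB ntAB.
have [_ _ defAB _ _] := sdprod_context defG.
rewrite -defAB -group_modl //.
have -> : B :&: 'C(A) = 1.
  apply: prime_TIg => //; apply: contra ntAB => cAB.
  by apply/eqP/commG1P; rewrite centsC.
by rewrite mulg1.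
Qed.

(** * Sections as graphs *)

Lemma mulg_morph1V (G H : groupType) (g : G -> H) :
  {morph g : x y / x * y >-> x * y} ->
  g 1 = 1 /\ forall x, g x^-1 = (g x)^-1.
Proof.
move=> gM; have g1 : g 1 = 1 by apply: (mulgI (g 1)); rewrite -gM !mulg1.
by split=> // x; apply: (mulgI (g x)); rewrite -gM !mulgV.
Qed.

(** Makes the finite group theory available for finite subgroups of an
    arbitrary group. *)
Lemma finite_subgroup_carrier (G : groupType) (H : set G) :
  is_subgroup H -> finite_set H ->
  exists (F : finGroupType) (i : F -> G),
    [/\ injective i, {morph i : x y / x * y >-> x * y} &
        forall x, H x <-> exists h, i h = x].
Proof.
move=> [H1 HM HV] /finite_seqP[s defH].
have Hs x : H x <-> x \in s by rewrite defH.
have closed_s : group_closed (fun x : G => x \in s).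
  by split=> [|x y /Hs Hx /Hs Hy]; apply/Hs => //; apply: (HM _ _ Hx (HV _ Hy)).
pose F : finGroupType :=
  HB.pack (seq_sub s) (SubChoice_isSubGroup.Build G _ (seq_sub s) closed_s).
exists F, (fun u => ssval u); split=> //; first exact: val_inj.
by move=> x; rewrite Hs; split=> [sx | [[y sy] <-] //]; exists (SeqSub sx).
Qed.

(** The graph of a homomorphism onto [D] from a subgroup of [G]: as [R] is itself
    a subgroup, it is single-valued as soon as it is so over [1].  Unlike a
    quotient by cosets, such a graph restricts and composes without choices. *)
Definition section_graph (D G : groupType) (R : set (D * G)) : Prop :=
  [/\ is_subgroup R, forall d, exists x, R (d, x) &
      forall d, R (d, 1) -> d = 1].

Lemma section_has_graph (D G : groupType) :
  is_section D G -> exists R : set (D * G), section_graph R.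
Proof.
case=> S [N [[S1 _ _] [[N1 NM NV] sNS _] [phi [phiS phi_inj phi_surj] phiM]]].
have cosetN n : N n -> left_coset n N = N.
  move=> Nn; apply/seteqP; split=> [_ [m Nm <-] | m Nm]; first exact: NM.
  by exists (n^-1 * m); rewrite ?mulKVg //; apply: NM => //; apply: NV.
have inj a b : phi a = phi b -> a = b.
  by move=> eq_ab; apply: phi_inj; rewrite ?classical_sets.in_setT.
(* [phi] is not assumed to preserve units; [N] is an idempotent for
   [set_product], so its preimage is an idempotent of [D]. *)
have phi1 : phi 1 = N.
  have [|e _ phie] := phi_surj (left_coset 1 N); first by exists 1.
  rewrite cosetN // in phie.
  suff <- : e = 1 by [].
  apply: (mulgI e); rewrite mulg1; apply: inj; rewrite phiM phie.
  apply/seteqP; split=> [_ [m Nm [n Nn <-]] | n Nn]; first exact: NM.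
  by exists 1 => //; exists n => //; rewrite mul1g.
have phi_coset d : exists2 x, S x & phi d = left_coset x N.
  by have [x Sx <-] := phiS d I; exists x.
exists [set u | phi u.1 u.2]%classic; split.
- split=> [|[a x] [b y] /= ax b_y|[d x] /= dx]; first by rewrite /= phi1.
    by rewrite phiM; exists x => //; exists y.
  have [z _ phiV] := phi_coset d^-1; rewrite phiV.
  have Nxz : N (x * z).
    rewrite -phi1 -(mulgV d) phiM; exists x => //; exists z => //.
    by rewrite phiV; exists 1; rewrite ?mulg1.
  by exists (x * z)^-1; [apply: NV | rewrite invMg mulKVg].
- move=> d; have [x _ phid] := phi_coset d; exists x; rewrite /= phid.
  by exists 1; rewrite ?mulg1.
move=> d /=; have [x _ phid] := phi_coset d; rewrite phid => -[n Nn xn1].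
apply: inj; rewrite phi1 phid cosetN //.
by rewrite -(mulgK n x) xn1 mul1g; apply: NV.
Qed.

(** The section is the second projection of [R] modulo the fibre of [R] over
    [1], and the coset attached to [d] is the fibre over [d]. *)
Lemma graph_section (D G : groupType) (R : set (D * G)) :
  section_graph R -> is_section D G.
Proof.
case=> [[R1 R_M R_V] Rtot Rinj].
have RM d x e y : R (d, x) -> R (e, y) -> R (d * e, x * y) by apply: R_M.
have RV d x : R (d, x) -> R (d^-1, x^-1) by apply: R_V.
have RVM d x e y : R (d, x) -> R (e, y) -> R (d^-1 * e, x^-1 * y).
  by move=> /RV dx ey; apply: RM dx ey.
have cosetE d x : R (d, x) ->
    left_coset x [set y | R (1, y)]%classic = [set y | R (d, y)]%classic.
  move=> dx; apply/seteqP; split=> [_ [n Rn <-] | y dy] /=.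
    by move: (RM _ _ _ _ dx Rn); rewrite mulg1.
  by exists (x^-1 * y); rewrite ?mulKVg //= -(mulVg d); apply: RVM.
exists [set x | exists d, R (d, x)]%classic, [set x | R (1, x)]%classic; split.
- split=> [|x y [d dx] [e ey]|x [d dx]]; first by exists 1.
    by exists (d * e); apply: RM dx ey.
  by exists d^-1; apply: RV dx.
- split=> [|x Rx|x n [d dx] Rn]; last 2 first.
  + by exists 1.
  + rewrite /= conjgE -(mulVg d) -{2}(mul1g d).
    by apply: (RVM _ _ _ _ dx); apply: RM Rn dx.
  split=> [//|x y Rx Ry|x Rx] /=; first by rewrite -(mulg1 1); apply: RM Rx Ry.
  by rewrite -invg1; apply: RV Rx.
exists (fun d => [set x | R (d, x)]%classic).
  split=> [d _ | d e _ _ eq_de | _ [x [d dx] <-]].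
  - by have [x dx] := Rtot d; exists x; [exists d | apply: cosetE].
  - have [x dx] := Rtot d.
    have ex : [set y | R (e, y)]%classic x by rewrite -eq_de.
    apply/esym/(mulgI d^-1); rewrite mulVg; apply: Rinj.
    by rewrite -(mulVg x); apply: RVM.
  - by exists d => //; rewrite (cosetE d).
move=> a b; apply/seteqP; split=> [z abz | _ [x ax [y b_y <-]]] /=;
  last exact: RM ax b_y.
have [x ax] := Rtot a; exists x => //; exists (x^-1 * z); rewrite ?mulKVg //=.
by rewrite -(mulKg a b); apply: RVM.
Qed.

Lemma subgroup_generated_subgroup (G : groupType) (A : set G) :
  is_subgroup (subgroup_generated A).
Proof.
split=> [H [[]] //|x y Ax Ay H HA|x Ax H HA].
  by case: (HA) => [[_ HM _] _]; apply: HM; [apply: Ax | apply: Ay].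
by case: (HA) => [[_ _ HV] _]; apply: HV; apply: Ax.
Qed.

(** * Reduction to a finite cover *)

Lemma locally_finite_range (T : finType) (G : groupType) (r : T -> G) :
  locally_finite G ->
  exists H : set G, [/\ is_subgroup H, finite_set H & forall t, H (r t)].
Proof.
move=> lfG; exists (subgroup_generated (range r)); split.
- exact: subgroup_generated_subgroup.
- apply: lfG (subgroup_generated_subgroup _) _.
  by exists (range r) => //; apply: finite_image; apply: finite_finset.
- by move=> t; apply: sub_gen_smallest; exists t.
Qed.

(** [F] is the part of a graph of the section lying over [HX * HY], where [HX]
    and [HY] are finite subgroups containing the coordinates of a chosen lift
    of every element of [D]. *)
Lemma finite_graph (D : finGroupType) (X Y : groupType) :
  locally_finite X -> locally_finite Y -> is_section D (X * Y)%type ->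
  exists (F : finGroupType) (f : F -> D) (g : F -> X) (h : F -> Y),
    [/\ [/\ {morph f : x y / x * y >-> x * y},
            {morph g : x y / x * y >-> x * y} &
            {morph h : x y / x * y >-> x * y}],
        forall d, exists u, f u = d &
        forall u, g u = 1 -> h u = 1 -> u = 1].
Proof.
move=> lfX lfY /section_has_graph[R [[R1 RM RV] /choice[r Rr] Rinj]].
have [HX [[HX1 HXM HXV] finX rX]] := locally_finite_range (fun d => (r d).1) lfX.
have [HY [[HY1 HYM HYV] finY rY]] := locally_finite_range (fun d => (r d).2) lfY.
pose K := (R `&` ([set: D] `*` (HX `*` HY)))%classic.
have K_subgroup : is_subgroup K.
  split=> [|u v [Ru [_ [u1 u2]]] [Rv [_ [v1 v2]]]|u [Ru [_ [u1 u2]]]].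
  - by split.
  - by split; [apply: RM | split=> //; split; [apply: HXM | apply: HYM]].
  - by split; [apply: RV | split=> //; split; [apply: HXV | apply: HYV]].
have K_finite : finite_set K.
  apply: sub_finite_set (@subIsetr _ _ _) _.
  by apply: finite_setX; [apply: finite_finset | apply: finite_setX].
have [F [i [i_inj iM iK]]] := finite_subgroup_carrier K_subgroup K_finite.
exists F, (fun u => (i u).1), (fun u => (i u).2.1), (fun u => (i u).2.2).
split; first by split=> u v; rewrite iM.
  move=> d; have /iK[u iu] : K (d, r d).
    by split; [apply: Rr | split=> //; split; [apply: rX | apply: rY]].
  by exists u; rewrite iu.
have [i1 _] := mulg_morph1V iM.
move=> u u1 u2; apply: i_inj; rewrite i1.
have [Ru _] : K (i u) by apply/iK; exists u.
case: (i u) u1 u2 Ru => d [x y] /= -> -> /Rinj -> //.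
Qed.

(** The graph of the section consists of the pairs [(f u, g u)] with [u] in [H]. *)
Lemma finite_cover_section (F D : finGroupType) (X : groupType)
    (f : {morphism [set: F] >-> D}) (g : F -> X) (H : {group F}) :
  {morph g : x y / x * y >-> x * y} -> f @* H = [set: D] ->
  (forall u, u \in H -> g u = 1 -> f u = 1) -> is_section D X.
Proof.
move=> gM fH gf1.
have [g1 gV] := mulg_morph1V gM.
apply: (@graph_section D X
  [set v | exists u, [/\ u \in H, f u = v.1 & g u = v.2]]%classic).
split.
- split=> [|x y [u [Hu fu gu]] [v [Hv fv gv]]|x [u [Hu fu gu]]].
  + by exists 1; rewrite group1 morph1.
  + by exists (u * v); rewrite groupM // morphM ?inE // gM fu fv gu gv.
  + by exists u^-1; rewrite groupV morphV ?inE // gV fu gu.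
- move=> d; have : d \in f @* H by rewrite fH inE.
  by case/morphimP=> u _ Hu ->; exists (g u), u.
by move=> d [u [Hu /= <- gu]]; apply: gf1.
Qed.

Lemma morph_kernel_group (F : finGroupType) (X : groupType) (g : F -> X) :
  {morph g : x y / x * y >-> x * y} ->
  exists2 K : {group F}, K <| [set: F] & forall u, (u \in K) = (g u == 1).
Proof.
move=> gM.
have [g1 gV] := mulg_morph1V gM.
have gK : group_set [set u | g u == 1].
  apply/group_setP; split=> [|u v]; rewrite !inE ?g1 // gM.
  by move=> /eqP-> /eqP->; rewrite mul1g.
exists (Group gK) => [|u]; last by rewrite inE.
apply/normalP; split=> [|v _]; first exact: subsetT.
apply/setP=> u; rewrite mem_conjg !inE conjgE invgK !gM gV.
apply/eqP/eqP=> [vu1 | ->]; last by rewrite mul1g mulgV.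
by apply: (mulgI (g v)); apply: (mulIg (g v)^-1); rewrite -mulgA vu1 mulg1 mulgV.
Qed.

Theorem mainTheorem1 (p q : nat) (D : finGroupType) (A B : {group D})
    (X Y : groupType) :
  prime p -> prime q -> p != q ->
  A ><| B = [set: D] ->
  cyclic A -> p.-group A ->
  cyclic B -> #|B| = q ->
  [~: A, B] != 1 ->
  locally_finite X -> locally_finite Y ->
  is_section D (X * Y)%type ->
  is_section D X \/ is_section D Y.
Proof.
move=> pr_p pr_q neq_pq defD cycA pA cycB oB ntAB lfX lfY DXY.
have [F [f0 [g [h [[fM gM hM] f_surj gh1]]]]] := finite_graph lfX lfY DXY.
pose f := @Morphism F D [set: F] f0 (in2W fM).
have fF : f @* [set: F] = [set: D].
  apply/setP=> d; rewrite [RHS]inE; have [u <-] := f_surj d.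
  by apply: mem_morphim; rewrite inE.
have [nsAD _ _ _ _] := sdprod_context defD.
have sylA : p.-Sylow([set: D]) A.
  rewrite pHallE subsetT /= -(sdprod_card defD) partnM //.
  rewrite part_pnat_id // part_p'nat ?muln1 // oB.
  by rewrite pnatE // !inE eq_sym.
have cAA : 'C_([set: D])(A) \subset A.
  by apply: sdprod_prime_cent defD (cyclic_abelian cycA) _ ntAB; rewrite oB.
have [K nsK inK] := morph_kernel_group gM.
have [L nsL inL] := morph_kernel_group hM.
have tiKL : K :&: L = 1.
  apply/trivgP/subsetP=> u; rewrite !inE inK inL => /andP[/eqP gu /eqP hu].
  by rewrite (gh1 u).
have nsAfF : A <| f @* [set: F] by rewrite fF.
rewrite -fF in sylA cAA.
have [H [_ fH] fHK] := cover_modulo_factor nsAfF sylA cycA cAA nsK nsL tiKL.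
rewrite fF in fH.
have trivial_on (M : {group F}) u :
    f @* (H :&: M) = 1 -> u \in H -> u \in M -> f u = 1.
  by move=> fHM Hu Mu; apply/set1gP; rewrite -fHM mem_morphim ?inE ?Hu.
case: fHK => /trivial_on fHK; [left | right].
  by apply: finite_cover_section gM fH _ => u Hu gu; rewrite fHK // inK gu.
by apply: finite_cover_section hM fH _ => u Hu gu; rewrite fHK // inL gu.
Qed.
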